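(* The function $\mathbf J_{\mathbb R}:\mathbb R\setminus\mathbb Q\to\widehat{\mathbb R}$ is continuous, where $\mathbb R\setminus\mathbb Q$ carries the subspace topology of $\mathbb R$ and $\widehat{\mathbb R}=\mathbb R\cup\{\infty\}$ is the one-point compactification of $\mathbb R$.
   Context: Definition of $\mathbf J_{\mathbb R}$: An infinite binary string $a\in\{0,1\}^\omega$ is written $a=0^{n_0}1^{n_1}0^{n_2}1^{n_3}\cdots$ with $n_0\ge 0$ and $n_i\ge 1$ for $i\ge1$; if $a$ is eventually constant the list of exponents is finite and its last entry is $\infty$. Put $\kappa(a)=[n_0,n_1,n_2,\dots]=n_0+\cfrac1{n_1+\cfrac1{n_2+\cdots}}\in[0,\infty]$, with $1/\infty=0$ and $[\infty]=\infty$. This is a bijection from not-eventually-constant strings to positive irrationals. Let $\phi=(01)^\omega=0101\dots$, $\phi^*=(10)^\omega=1010\dots$, and let $\oplus$ be term-wise exclusive or. The map $\mathbf J_{\mathbb R}:\mathbb R\setminus\mathbb Q\to\widehat{\mathbb R}$ is: if $x>0$ is irrational and $x=\kappa(a)$, then $\mathbf J_{\mathbb R}(x)=\kappa(a\oplus\phi)$; if $x<0$ is irrational and $-1/x=\kappa(a)$, then $\mathbf J_{\mathbb R}(x)=-1/\kappa(a\oplus\phi^* )$ (with $1/0=\infty$, $1/\infty=0$). *)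

(* Defs.v *)
From mathcomp Require Import all_boot all_order all_algebra.
From mathcomp Require Import all_classical all_reals all_analysis.

Set Implicit Arguments.
Unset Strict Implicit.
Unset Printing Implicit Defensive.

Import Order.TTheory GRing.Theory Num.Theory.
Import numFieldNormedType.Exports.

Local Open Scope classical_set_scope.
Local Open Scope ring_scope.

Definition binary_string : Type := nat -> bool.

(* Length of the maximal prefix of [a] all of whose digits are [b];
   [None] stands for an infinite length. *)
Definition run (b : bool) (a : binary_string) : option nat :=
  if pselect (exists m, a m != b) is left ex_m then Some (ex_minn ex_m)
  else None.

(* The first [k] lengths of the alternating blocks of [a], whose first block
   (possibly of length 0) consists of [b]s. The list is shorter than [k]
   exactly when an infinite block, recorded by [+oo], is met before the
   [k]-th one. For [b = false] these are n_0, n_1, n_2, ... where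
   a = 0^n_0 1^n_1 0^n_2 ... *)
Fixpoint exponents (R : realType) (k : nat) (b : bool) (a : binary_string) :
    seq (\bar R) :=
  if k is k'.+1 then
    if run b a is Some n
    then (n%:R)%:E :: exponents R k' (~~ b) (fun m => a (n + m)%N)
    else [:: +oo%E]
  else [::].

(* [n_0, ..., n_k] = n_0 + 1/(n_1 + 1/(... + 1/n_k)), computed with
   1/+oo = 0; the empty fraction is +oo, so that [n_k] = n_k + 1/+oo = n_k. *)
Fixpoint cfrac (R : realType) (s : seq (\bar R)) : \bar R :=
  if s is n :: s' then (n + (cfrac s')^-1)%E else +oo%E.

(* If [a] is eventually constant the sequence below is stationary at the value
   of the finite continued fraction [n_0, ..., n_k, +oo]; otherwise it is the
   sequence of convergents of [n_0, n_1, n_2, ...]. *)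
Definition kappa (R : realType) (a : binary_string) : \bar R :=
  limn (fun k => cfrac (exponents R k false a)).

Definition phi : binary_string := fun n => odd n.

Definition phi_star : binary_string := fun n => ~~ odd n.

Definition xor_string (a b : binary_string) : binary_string :=
  fun n => a n (+) b n.

(* The binary string [a] with [kappa a = x]. It exists and is unique for every
   irrational [x > 0]; the default value is irrelevant. *)
Definition kappa_code (R : realType) (x : R) : binary_string :=
  xget (fun=> false) [set a : binary_string | kappa R a = x%:E].

(* Identifies -oo and +oo with the point at infinity [None]. *)
Definition to_Rhat (R : realType) (x : \bar R) : one_point_compactification R :=
  if x is r%:E then Some r else None.

(* Only the values at irrational points are meaningful. In the negative case,
   the inverse on [\bar R] satisfies 0^-1 = +oo and +oo^-1 = 0. *)
Definition J_R (R : realType) (x : R) : one_point_compactification R :=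
  if 0 < x then
    to_Rhat (kappa R (xor_string (kappa_code x) phi))
  else
    to_Rhat (- (kappa R (xor_string (kappa_code (- x^-1)) phi_star))^-1)%E.

(* Main.v *)
Require Import Defs.
From mathcomp Require Import all_boot all_order all_algebra.
From mathcomp Require Import all_classical all_reals all_analysis.
From mathcomp Require Import ring lra.

(** Prefixing a string with a digit acts on values by a homography,
    [kappa (0a) = 1 + kappa a] and [kappa (1a) = kappa a / (1 + kappa a)].
    The homeomorphism [contract : x |-> x / (1 + x)] from [[0, +oo]] onto
    [[0, 1]] turns these two homographies into the self-maps
    [s |-> 1 / (2 - s)] and [s |-> s / (1 + s)] of [[0, 1]] ([digit_map]), so
    that [kappa] becomes the coding of [[0, 1]] by their compositions
    ([prefix_map]): the strings with a given prefix [w] take their values in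
    the image of [[0, 1]] under [prefix_map w], an interval between two
    neighbouring Farey fractions. Three facts on these intervals carry the
    proof.

    - For a prefix of length [n] the width is at most [1 / (n + 1)]
      ([prefix_map_width]). Since the values of the convergents end up in every
      interval of the string ([mirror_convergent]), they converge and [kappa a]
      lies in all of them ([kappa_prefix]); hence [kappa] is uniformly
      continuous for the metric of [contract], which is the metric of [\bar R]
      ([kappa_common_prefix]).
    - The intervals of a given length cover [[0, 1]], so every nonnegative
      extended real has a code ([kappa_surj]).
    - The intervals of a given length overlap only at their endpoints
      ([prefix_map_overlap]), which are rational. An irrational point is
      therefore interior to its intervals, and the codes of the points near it
      share any prescribed prefix of its own code ([kappa_code_near]).

    The exclusive or with a fixed string preserves common prefixes, so
    [x |-> kappa (code x (+) f)] is continuous at each positive irrational.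
    [J_R] is obtained from such maps by composition with continuous maps:
    the quotient map from [\bar R] to the circle and, on the negative side,
    [x |-> -1/x] before and after; on [[0, +oo]] the inverse is continuous even
    at [0] because [contract] turns it into the reflection [s |-> 1 - s]. *)

Set Implicit Arguments.
Unset Strict Implicit.
Unset Printing Implicit Defensive.

Import Order.TTheory GRing.Theory Num.Theory.
Import numFieldNormedType.Exports.

Local Open Scope classical_set_scope.
Local Open Scope ring_scope.

(** * The digit maps and their compositions *)

(** Stated over any field because the endpoints of the intervals are also
    computed in [rat]. *)
Definition digit_map (F : fieldType) (b : bool) (s : F) : F :=
  if b then s / (1 + s) else (2 - s)^-1.

Definition prefix_map (F : fieldType) (w : seq bool) (s : F) : F :=
  foldr (@digit_map F) s w.

Section DigitMaps.
Variable R : realFieldType.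
Implicit Types (b : bool) (s t : R) (w : seq bool).

(** The reflection of [[0, 1]] is [x |-> 1/x] on [[0, +oo]]; exchanging the two
    digits of a string inverts its value. *)
Lemma digit_map_sym b s : 0 <= s <= 1 ->
  digit_map (~~ b) (1 - s) = 1 - digit_map b s.
Proof.
move=> /andP[s0 s1]; rewrite /digit_map; case: b => /=.
  by field; do ?(apply/andP; split); lra.
by field; do ?(apply/andP; split); lra.
Qed.

Lemma digit_map_01 b s : 0 <= s <= 1 -> 0 <= digit_map b s <= 1.
Proof.
move=> /andP[s0 s1]; rewrite /digit_map; case: b.
  by rewrite ler_pdivlMr ?ler_pdivrMr; lra.
by rewrite -[(2 - s)^-1]div1r ler_pdivlMr ?ler_pdivrMr; lra.
Qed.

Lemma digit_map_half b s : 0 <= s <= 1 ->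
  if b then digit_map b s <= 2^-1 else 2^-1 <= digit_map b s.
Proof.
move=> /andP[s0 s1]; rewrite /digit_map; case: b.
  by rewrite ler_pdivrMr; lra.
by rewrite -[(2 - s)^-1]div1r ler_pdivlMr; lra.
Qed.

Lemma ltr_digit_map b s t : 0 <= s <= 1 -> 0 <= t <= 1 ->
  (digit_map b s < digit_map b t) = (s < t).
Proof.
move=> /andP[s0 s1] /andP[t0 t1]; rewrite /digit_map; case: b.
  rewrite ltr_pdivrMr; last lra.
  rewrite mulrAC ltr_pdivlMr; last lra.
  by apply/idP/idP => h; nra.
rewrite ltf_pV2 ?posrE; [|lra|lra].
by apply/idP/idP => h; lra.
Qed.

Lemma digit_map_surj s : 0 <= s <= 1 ->
  exists b t, 0 <= t <= 1 /\ s = digit_map b t.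
Proof.
move=> /andP[s0 s1]; have [h|h] := leP s 2^-1.
  exists true, (s / (1 - s)); rewrite /digit_map; split.
    by rewrite ler_pdivlMr ?ler_pdivrMr; lra.
  by field; do ?(apply/andP; split); lra.
exists false, (2 - s^-1); rewrite /digit_map; split.
  have : s * s^-1 = 1 by rewrite divff //; lra.
  by move=> ?; apply/andP; split; nra.
by field; lra.
Qed.

Lemma prefix_map_01 w s : 0 <= s <= 1 -> 0 <= prefix_map w s <= 1.
Proof. by move=> s01; elim: w => //= b w; apply: digit_map_01. Qed.

Lemma prefix_map_rcons w b s :
  prefix_map (rcons w b) s = prefix_map w (digit_map b s).
Proof. exact: foldr_rcons. Qed.

(** [p] and [q] are the denominators of the two neighbouring Farey fractions
    that bound the image of [[0, 1]]; a further digit replaces one of them by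
    their mediant denominator [p + q], so that their sum grows with the length
    of [w]. *)
Lemma prefix_map_diff w : exists p q : R,
  [/\ 1 <= p, 1 <= q, (size w).+2%:R <= p + q &
      forall s t, 0 <= s <= 1 -> 0 <= t <= 1 ->
        prefix_map w t - prefix_map w s =
        (t - s) / ((p * (1 - s) + q * s) * (p * (1 - t) + q * t))].
Proof.
elim/last_ind: w => [|w b [p [q [p1 q1 pq dist]]]].
  exists 1, 1; split => //= s t _ _.
  by rewrite !mul1r !subrK mulr1 divr1.
case: b; [exists p, (p + q) | exists (p + q), q]; split; rewrite ?size_rcons.
- by [].
- lra.
- by rewrite -natr1; lra.
- move=> s t s01 t01.
  rewrite !prefix_map_rcons dist; [|exact: digit_map_01|exact: digit_map_01].
  move: s01 t01 => /andP[s0 s1] /andP[t0 t1]; rewrite /digit_map.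
  have hs' : p * (1 - s) + (p + q) * s > 0 by nra.
  have ht' : p * (1 - t) + (p + q) * t > 0 by nra.
  field; rewrite !gt_eqF//=; nra.
- lra.
- by [].
- by rewrite -natr1; lra.
- move=> s t s01 t01.
  rewrite !prefix_map_rcons dist; [|exact: digit_map_01|exact: digit_map_01].
  move: s01 t01 => /andP[s0 s1] /andP[t0 t1]; rewrite /digit_map.
  have hs' : (p + q) * (1 - s) + q * s > 0 by nra.
  have ht' : (p + q) * (1 - t) + q * t > 0 by nra.
  field; rewrite !gt_eqF//=; nra.
Qed.

(** The width is [1 / (p * q)], and [p * q >= p + q - 1] as [p] and [q] are at
    least [1]. *)
Lemma prefix_map_width w : prefix_map w (1 : R) - prefix_map w 0 <= (size w).+1%:R^-1.
Proof.
have [p [q [p1 q1 pq ->]]] := prefix_map_diff w; [|lra|lra].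
rewrite !subr0 !mulr1 !mulr0 subrr mulr0 addr0 add0r div1r.
rewrite lef_pV2 ?posrE ?ltr0n//; last by nra.
move: pq; rewrite -natr1 => pq; nra.
Qed.

Lemma le_prefix_map w s t : 0 <= s -> s <= t -> t <= 1 ->
  prefix_map w s <= prefix_map w t.
Proof.
move=> s0 st t1; have [p [q [p1 q1 pq h]]] := prefix_map_diff w.
rewrite -subr_ge0 h; [|lra|lra].
by rewrite divr_ge0 ?subr_ge0// mulr_ge0 //; nra.
Qed.

Lemma dist_in_prefix w s t :
  prefix_map w 0 <= s <= prefix_map w 1 ->
  prefix_map w 0 <= t <= prefix_map w 1 ->
  `|s - t| <= (size w).+1%:R^-1.
Proof.
move=> /andP[s0 s1] /andP[t0 t1].
have width := prefix_map_width w.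
apply: le_trans width; rewrite ler_norml; apply/andP; split; lra.
Qed.

(** Two different words of the same length first differ at some digit, and
    there the two digit maps have their images on both sides of [1/2]. *)
Lemma prefix_map_overlap w v : size w = size v ->
  prefix_map w (0 : R) < prefix_map v 1 -> prefix_map v 0 < prefix_map w (1 : R) ->
  w = v.
Proof.
have p0 u : 0 <= prefix_map u (0 : R) <= 1 by apply: prefix_map_01; rewrite lexx ler01.
have p1 u : 0 <= prefix_map u (1 : R) <= 1 by apply: prefix_map_01; rewrite lexx ler01.
elim: w v => [|b w IH] [|c v] //= [wv].
have [<-|bc] := eqVneq b c.
  by rewrite !ltr_digit_map // => lt1 lt2; rewrite (IH v).
have b0 := digit_map_half b (p0 w); have b1 := digit_map_half b (p1 w).
have c0 := digit_map_half c (p0 v); have c1 := digit_map_half c (p1 v).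
case: b c bc b0 b1 c0 c1 => -[] // _ b0 b1 c0 c1 lt1 lt2.
  by have := le_lt_trans c0 (lt_le_trans lt2 b1); rewrite ltxx.
by have := le_lt_trans b0 (lt_le_trans lt1 c1); rewrite ltxx.
Qed.

Lemma prefix_map_rat w (q : rat) : prefix_map w (ratr q) = ratr (prefix_map w q) :> R.
Proof.
elim: w => //= b w ->; rewrite /digit_map; case: b.
  by rewrite fmorph_div rmorphD rmorph1.
by rewrite fmorphV rmorphB rmorph_nat.
Qed.

End DigitMaps.

(** * The homeomorphism from [[0, +oo]] onto [[0, 1]] *)

Section Contract.
Variable R : realType.
Implicit Types (x : \bar R).

Lemma contract_01 x : (0 <= x)%E -> 0 <= contract x <= 1.
Proof.
move=> x0; rewrite -(contract0 R) le_contract x0 /=.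
exact: le_trans (ler_norm _) (contract_le1 x).
Qed.

Lemma contractD1 x : (0 <= x)%E -> contract (1 + x)%E = digit_map false (contract x).
Proof.
rewrite /digit_map; case: x => [r||] //=; last by move=> _; field.
rewrite lee_fin => r0; rewrite !ger0_norm; [|lra|lra].
by field; do ?(apply/andP; split); lra.
Qed.

Lemma contractV x : (0 <= x)%E -> contract x^-1%E = 1 - contract x.
Proof.
case: x => [r||] //=; last by rewrite mul0r subrr.
rewrite lee_fin le_eqVlt => /predU1P[<-|r0].
  by rewrite inver eqxx /= mul0r subr0.
rewrite inver gt_eqF //= !ger0_norm; [|lra|by rewrite invr_ge0 ltW].
by field; do ?(apply/andP; split); lra.
Qed.

End Contract.

(** * First digits of a string and lengths of its blocks *)

Definition shift (a : binary_string) : binary_string := fun m => a m.+1.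

Lemma mkseq_shift a n : mkseq a n.+1 = a 0%N :: mkseq (shift a) n.
Proof. by rewrite /mkseq /= (iotaDl 1 0) -map_comp. Qed.

Lemma run_neq b a : a 0%N = ~~ b -> run b a = Some 0%N.
Proof.
move=> a0; have neq : a 0%N != b by rewrite a0; case: (b).
rewrite /run; case: pselect => [h|[]]; last by exists 0%N.
case: ex_minnP => m _ /(_ 0%N neq).
by rewrite leqn0 => /eqP ->.
Qed.

Lemma run_eq b a : a 0%N = b -> run b a = omap succn (run b (shift a)).
Proof.
rewrite /run => a0; case: pselect => h; case: pselect => h' //=.
- case: ex_minnP => m am min_m; case: ex_minnP => n an min_n; congr Some.
  case: m am min_m => [|m] am min_m; first by rewrite a0 eqxx in am.
  by congr succn; apply/eqP; rewrite eqn_leq min_n // -ltnS min_m.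
- exfalso; case: h => -[|m] am; first by rewrite a0 eqxx in am.
  by case: h'; exists m.
- by exfalso; case: h' => m am; case: h; exists m.+1.
Qed.

(** * The intervals that contain the value of a string *)

Section Convergents.
Variable R : realType.
Implicit Types (a : binary_string) (b : bool) (k n : nat).

Definition convergent k b a := cfrac (exponents R k b a).

Lemma convergent_ge0 k b a : (0 <= convergent k b a)%E.
Proof.
rewrite /convergent; elim: k b a => //= k IH b a; case: (run b a) => [n|] /=.
  by rewrite adde_ge0 ?lee_fin ?ler0n // inve_ge0.
by rewrite adde_ge0 // invey.
Qed.

Lemma convergent_eq k b a : a 0%N = b ->
  convergent k.+1 b a = (1 + convergent k.+1 b (shift a))%E.
Proof.
move=> a0; rewrite /convergent /= (run_eq a0); case: (run b (shift a)) => [n|] //=.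
by rewrite addeA -EFinD -natr1 [(n%:R + 1)%R]addrC.
Qed.

Lemma convergent_neq k b a : a 0%N = ~~ b ->
  convergent k.+1 b a = (convergent k (~~ b) a)^-1%E.
Proof. by move=> a0; rewrite /convergent /= (run_neq a0) /= add0e. Qed.

(** A convergent whose blocks are read from [1]s on ([b = true]) is the inverse
    of the value aimed at; [mirror true] undoes this inversion, so that
    [mirror b (contract (convergent k b a))] approximates the value of [a] for
    both [b]. *)
Definition mirror b (s : R) := if b then 1 - s else s.

(** Reading a digit equal to [b] lowers the length of the current block by one
    and keeps [k]; when the digit differs from [b] an empty block has to be
    skipped first, which costs one unit of [k] and exchanges the roles of the
    digits. So each digit uses at most one of the [k] blocks. The inequality is
    strict because the empty fraction [k = 0] satisfies neither recursion. *)
Lemma mirror_convergent k n b a : (n < k)%N ->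
  exists2 s, 0 <= s <= 1 &
    mirror b (contract (convergent k b a)) = prefix_map (mkseq a n) s.
Proof.
have K01 k' b' a' : 0 <= contract (convergent k' b' a') <= 1.
  exact/contract_01/convergent_ge0.
elim: n k b a => [|n IH] k b a nk.
  exists (mirror b (contract (convergent k b a))) => //.
  by move: (K01 k b a); rewrite /mirror; case: b; lra.
have same k' b' a' : (n < k'.+1)%N -> a' 0%N = b' -> exists2 s, 0 <= s <= 1 &
    mirror b' (contract (convergent k'.+1 b' a')) = prefix_map (mkseq a' n.+1) s.
  move=> nk' a'0.
  have [s s01 e] := IH k'.+1 b' (shift a') nk'; exists s => //.
  rewrite mkseq_shift /= a'0 -/(prefix_map _ _) -e.
  rewrite convergent_eq // contractD1 ?convergent_ge0 //.
  by rewrite /mirror; case: b' {e a'0} => //=; rewrite -(digit_map_sym false).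
case: k nk => // k nk; have [a0|a0] := eqVneq (a 0%N) b.
  by apply: same => //; exact: ltnW.
have {}a0 : a 0%N = ~~ b by case: (a 0%N) b a0 => -[].
case: k nk => // k nk; have [s s01 e] := same k _ _ nk a0; exists s => //.
rewrite -e convergent_neq // contractV ?convergent_ge0 //.
by rewrite /mirror; case: b {e a0} => //=; rewrite subKr.
Qed.

(** The intervals of [a] all contain late convergents, hence are pairwise
    compatible; the supremum of their lower ends lies in each of them, and the
    convergents tend to it because the widths tend to [0]. *)
Lemma kappa_prefix a n : prefix_map (mkseq a n) 0 <= contract (kappa R a)
  <= prefix_map (mkseq a n) 1.
Proof.
pose f m (s : R) := prefix_map (mkseq a m) s.
have conv m k : (m < k)%N -> f m 0 <= contract (convergent k false a) <= f m 1.
  move=> mk; have [s /andP[s0 s1] /= ->] := mirror_convergent false a mk.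
  by rewrite !le_prefix_map.
have f01 m m' : f m 0 <= f m' 1.
  have /andP[h _] := conv m (maxn m m').+1 (leq_maxl m m').
  have /andP[_ h'] := conv m' (maxn m m').+1 (leq_maxr m m').
  exact: le_trans h h'.
pose lows := range (fun m => f m 0).
have lowsP m : f m 0 <= sup lows <= f m 1.
  apply/andP; split.
    apply: ub_le_sup; last by exists m.
    by exists (f 0%N 1) => _ [i _ <-].
  by apply: ge_sup => [|_ [i _ <-] //]; exists (f 0%N 0), 0%N.
suff -> : contract (kappa R a) = sup lows by exact: lowsP.
have sup01 : `|sup lows| <= 1.
  by have := lowsP 0%N; rewrite /f /= ler_norml => /andP[? ?]; apply/andP; split; lra.
rewrite -[RHS]expandK //; congr contract.
apply: (@cvg_lim (\bar R)); first exact: ereal_hausdorff.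
apply/cvg_ballP => e e0; have [N _ hN] := near_infty_natSinv_lt (PosNum e0).
near=> k.
rewrite /ball /= /ereal_ball expandK //.
have Nk : (N < k)%N by near: k; exact: nbhs_infty_gt.
apply: (le_lt_trans _ (hN N (leqnn N))).
have := dist_in_prefix (lowsP N) (conv N k Nk); rewrite size_mkseq; exact.
Unshelve. all: end_near. Qed.

Lemma kappa_ge0 a : (0 <= kappa R a)%E.
Proof. by have /andP[] := kappa_prefix a 0; rewrite -(contract0 R) le_contract. Qed.

Lemma kappa_common_prefix a c n : mkseq a n = mkseq c n ->
  `|contract (kappa R a) - contract (kappa R c)| <= n.+1%:R^-1.
Proof.
move=> ac; rewrite -[n in n.+1](size_mkseq a).
by apply: dist_in_prefix; [|rewrite ac]; exact: kappa_prefix.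
Qed.

(** * Codes of real numbers *)

(** The orbit of [contract x] under a choice of inverse branches of the digit
    maps spells a code of [x]; uniqueness fails at the
    positive rationals, whose orbits reach [1/2], where both branches apply. *)
Lemma kappa_surj (x : \bar R) : (0 <= x)%E -> exists a, kappa R a = x.
Proof.
move=> x0; have s01 := contract_01 x0; set s := contract x in s01.
have step t : exists bt : bool * R, 0 <= t <= 1 ->
    0 <= bt.2 <= 1 /\ t = digit_map bt.1 bt.2.
  (* Outside [[0, 1]] any value will do, as the orbit never gets there. *)
  have [t01|] := boolP (0 <= t <= 1); last by exists (true, t).
  by have [b [u ?]] := digit_map_surj t01; exists (b, u).
have [F FP] := boolp.choice step.
pose orbit n := iter n (fun t => (F t).2) s.
pose a : binary_string := fun n => (F (orbit n)).1.
have orbit01 n : 0 <= orbit n <= 1.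
  by elim: n => [|n /FP[]].
have prefix n : s = prefix_map (mkseq a n) (orbit n).
  elim: n => [|n IH] //.
  by rewrite mkseqS prefix_map_rcons -(FP _ (orbit01 n)).2 -IH.
exists a; apply: contract_inj; apply/eqP; rewrite -/s -subr_eq0 -normr_le0.
apply/ler_addgt0Pl => e e0; rewrite addr0.
have [N _ /(_ N (leqnn N)) /= hN] := near_infty_natSinv_lt (PosNum e0).
apply: (le_trans _ (ltW hN)).
have /andP[t0 t1] := orbit01 N.
rewrite (prefix N) -[N in N.+1](size_mkseq a).
by apply: dist_in_prefix (kappa_prefix a N) _; rewrite !le_prefix_map.
Qed.

Lemma kappa_codeK (x : R) : 0 <= x -> kappa R (kappa_code x) = x%:E.
Proof. by move=> x0; apply: (xgetPex _ (@kappa_surj x%:E _)); rewrite lee_fin. Qed.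

Lemma irrational_neq_prefix_map w (x : R) (q : rat) : 0 < x -> @irrational R x ->
  contract x%:E != prefix_map w (ratr q).
Proof.
move=> x0 irr; apply/eqP; rewrite prefix_map_rat /= ger0_norm ?ltW //.
set p := prefix_map _ _ => e; apply: irr; exists (p / (1 - p)) => //.
rewrite fmorph_div rmorphB rmorph1 /= -e; field.
by do ?(apply/andP; split); lra.
Qed.

Lemma irrational_interior a n (x : R) : 0 < x -> @irrational R x ->
  kappa R a = x%:E ->
  prefix_map (mkseq a n) 0 < contract x%:E < prefix_map (mkseq a n) 1.
Proof.
move=> x0 irr ax; have := kappa_prefix a n.
have := irrational_neq_prefix_map (mkseq a n) 0 x0 irr.
have := irrational_neq_prefix_map (mkseq a n) 1 x0 irr.
rewrite ax rmorph0 rmorph1 => neq1 neq0 /andP[ge0 le1].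
by rewrite !lt_neqAle ge0 le1 neq1 eq_sym neq0.
Qed.

(** The points [y] near [x] are arbitrary reals: at a rational [y] either code
    shares the prefix, so that the choice made by [kappa_code] does not
    matter. *)
Lemma kappa_code_near (x : R) n : 0 < x -> @irrational R x ->
  \forall y \near x, mkseq (kappa_code y) n = mkseq (kappa_code x) n.
Proof.
move=> x0 irr.
have /andP[lo hi] := irrational_interior n x0 irr (kappa_codeK (ltW x0)).
set w := mkseq _ n in lo hi *.
have contract_near e : 0 < e -> \forall y \near x, `|contract x%:E - contract y%:E| < e.
  move=> e0; have : EFin @ x --> x%:E by [].
  by move=> /cvg_ballP /(_ e e0).
near=> y.
have y0 : 0 <= y by near: y; exact: (cvgr_ge x cvg_id).
have /andP[ylo yhi] := kappa_prefix (kappa_code y) n.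
rewrite (kappa_codeK y0) in ylo yhi.
apply/esym/prefix_map_overlap; rewrite ?size_mkseq //.
  apply: lt_le_trans yhi.
  have : `|contract x%:E - contract y%:E| < contract x%:E - prefix_map w 0.
    by near: y; apply: contract_near; rewrite subr_gt0.
  by rewrite ltr_norml => /andP[? ?]; lra.
apply: le_lt_trans ylo _.
have : `|contract x%:E - contract y%:E| < prefix_map w 1 - contract x%:E.
  by near: y; apply: contract_near; rewrite subr_gt0.
by rewrite ltr_norml => /andP[? ?]; lra.
Unshelve. all: end_near. Qed.

Lemma kappa_xor_code_cvg (f : binary_string) (x : R) : 0 < x -> @irrational R x ->
  kappa R (xor_string (kappa_code y) f) @[y --> x] -->
  kappa R (xor_string (kappa_code x) f).
Proof.
move=> x0 irr; apply/cvg_ballP => e e0.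
have [n _ /(_ n (leqnn n)) /= hn] := near_infty_natSinv_lt (PosNum e0).
near=> y; apply: le_lt_trans hn; apply: kappa_common_prefix.
rewrite /xor_string; apply/eq_in_map => i; rewrite mem_iota => /= i_n.
congr addb; have : mkseq (kappa_code y) n = mkseq (kappa_code x) n.
  by near: y; exact: kappa_code_near.
by move=> /(congr1 (fun w => nth false w i)); rewrite !nth_mkseq.
Unshelve. all: end_near. Qed.

(** * Continuity of the involution *)

(** Compact sets of reals are bounded, so a neighbourhood of the point at
    infinity contains neighbourhoods of both ends of [\bar R]. *)
Lemma to_Rhat_continuous : continuous (@to_Rhat R).
Proof.
have infty A : nbhs (None : one_point_compactification R) A ->
    exists M : R, forall x : \bar R, (M%:E < `|x|)%E -> A (to_Rhat x).
  case=> C [/compact_bounded[M [Mreal CM]] _] CA; exists (M + 1) => x Mx.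
  apply: CA; case: x Mx => [r| |] /= Mr; [left|by right|by right].
  exists r => // /(CM (M + 1)); rewrite ltrDl ltr01 => /(_ isT) /=.
  by move: Mr; rewrite lte_fin ltNge => /negPf ->.
case=> [r| |] A //= /infty[M AM].
  by exists M; split; [exact: num_real|move=> x Mx; apply/AM/(lt_le_trans Mx)/lee_abs].
exists (- M); split; first exact: num_real.
move=> x Mx; apply/AM; rewrite -abseN; apply: lt_le_trans (lee_abs _).
by rewrite lteNr -EFinN.
Qed.

(** On [[0, +oo]] the inverse is an isometry for the metric of [\bar R]. *)
Lemma inve_cvg T (F : set_system T) (FF : Filter F) (h : T -> \bar R) l :
  (forall t, 0 <= h t)%E -> (0 <= l)%E -> h @ F --> l -> ((h t)^-1)%E @[t --> F] --> l^-1%E.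
Proof.
move=> h0 l0 /cvg_ballP hl; apply/cvg_ballP => e /hl; apply: filterS => t.
rewrite /ball /= /ereal_ball !contractV // distrC.
by rewrite (_ : 1 - _ - (1 - _) = contract (h t) - contract l) //; ring.
Qed.

(** Stronger than continuity on the subspace of irrationals: the nearby points
    may be rational. *)
Lemma J_R_continuous_at (x : R) : @irrational R x -> {for x, continuous (@J_R R)}.
Proof.
move=> irr.
have x_neq0 : x != 0.
  by apply/eqP => xE; apply: irr; exists 0 => //; rewrite rmorph0 xE.
have [x0|] := ltP 0 x.
  have Jx : {near x, (fun y => to_Rhat (kappa R (xor_string (kappa_code y) phi))) =1 @J_R R}.
    by near=> y; rewrite /J_R ifT //; near: y; exact: (cvgr_gt x cvg_id).
  rewrite /prop_for /continuous_at [J_R x]/J_R x0.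
  apply: cvg_trans (near_eq_cvg Jx) _.
  by apply: continuous_cvg; [exact: to_Rhat_continuous|exact: kappa_xor_code_cvg].
rewrite le_eqVlt (negPf x_neq0) /= => x0.
pose g (y : R) := kappa R (xor_string (kappa_code y) phi_star).
have Jx : {near x, (fun y => to_Rhat (- (g (- y^-1)%R)^-1)%E) =1 @J_R R}.
  by near=> y; rewrite /J_R ifF //; apply/negbTE; rewrite -leNgt; near: y; exact: (cvgr_le x cvg_id).
rewrite /prop_for /continuous_at [J_R x]/J_R ltNge ltW //=.
apply: cvg_trans (near_eq_cvg Jx) _.
apply: continuous_cvg; first exact: to_Rhat_continuous.
apply: continuous_cvg; first exact: oppe_continuous.
apply: inve_cvg => [t| |]; [exact: kappa_ge0|exact: kappa_ge0|].
have gx : g @ (- x^-1) --> g (- x^-1).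
  apply: kappa_xor_code_cvg; first by rewrite oppr_gt0 invr_lt0.
  by move=> [q _ qx]; apply: irr; exists (- q^-1) => //; rewrite rmorphN fmorphV /= qx invrN invrK opprK.
apply: cvg_comp gx; apply: cvgN; exact: cvgV.
Unshelve. all: end_near. Qed.
End Convergents.

Theorem theorem13 (R : realType) : {within @irrational R, continuous (@J_R R)}.
Proof.
by apply: continuous_in_subspaceT => x; rewrite inE; exact: J_R_continuous_at.
Qed.
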